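(* Let $\alpha>0$, let $M\in\mathbb{R}^{n\times n}$ be symmetric with $M\succeq 0$, and let $\mathcal{E}=\{\xi\in\mathbb{R}^n \mid \xi^\top M\xi\le 1\}$. Consider the ambiguity set $\mathcal{D}_\alpha(\gamma_1,\gamma_2,\mathbb{R}^n)$ of all $\alpha$-unimodal distributions with unbounded support $\Xi=\mathbb{R}^n$ subject to the moment constraints given in the context. Then $$\sup_{\mathbb{P}\in\mathcal{D}_\alpha(\gamma_1,\gamma_2,\mathbb{R}^n)}\mathbb{P}\{\xi\notin\mathcal{E}\}\le\begin{cases} c_\alpha\gamma_2\,\mathrm{Tr}\{MS_0\}, & \text{if } c_\alpha\gamma_2\,\mathrm{Tr}\{MS_0\}\le \dfrac{\alpha}{\alpha+2},\\[2mm] 1-\dfrac{1}{\left(\gamma_2\,\mathrm{Tr}\{MS_0^\alpha\}\right)^{\alpha/2}}, & \text{otherwise.}\end{cases}$$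
   Context: A probability distribution $\mathbb{P}$ on $\mathbb{R}^n$ is $\alpha$-unimodal about $0$ ($\alpha>0$) if $t^\alpha\,\mathbb{P}(\mathcal{S}/t)$ is non-decreasing in $t\in(0,\infty)$ for every Borel set $\mathcal{S}\subseteq\mathbb{R}^n$. $\mathscr{P}_\alpha$ is the set of all distributions that are $\alpha$-unimodal about $0$. Given a support $\Xi\subseteq\mathbb{R}^n$, a nominal mean $\mu_0=0$, a nominal covariance $S_0\succ0$ in $\mathbb{R}^{n\times n}$, and size parameters $\gamma_1\ge 0$, $\gamma_2\ge\max\{\gamma_1,1\}$, the moment-based ambiguity set $\mathcal{D}(\gamma_1,\gamma_2,\Xi)$ is the set of all probability distributions $\mathbb{P}$ of $\xi$ with $\mathbb{P}\{\xi\in\Xi\}=1$, $\ (\mathbb{E}_{\mathbb{P}}\{\xi\}-\mu_0)^\top S_0^{-1}(\mathbb{E}_{\mathbb{P}}\{\xi\}-\mu_0)\le\gamma_1$, and $\ \mathbb{E}_{\mathbb{P}}\{(\xi-\mu_0)(\xi-\mu_0)^\top\}\preceq\gamma_2S_0$. The structured ambiguity set is $\mathcal{D}_\alpha(\gamma_1,\gamma_2,\Xi)=\mathcal{D}(\gamma_1,\gamma_2,\Xi)\cap\mathscr{P}_\alpha$. Constants: $c_\alpha=\left(\frac{2}{\alpha+2}\right)^{2/\alpha}$ and $S_0^\alpha=\frac{\alpha+2}{\alpha}S_0$ (here $\alpha$ in $S_0^\alpha$ is a superscript label, not a power). *)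

(* Defs.v *)
From mathcomp Require Import all_boot all_order all_algebra.
From mathcomp Require Import all_classical all_reals all_analysis.
Set Implicit Arguments.
Unset Strict Implicit.
Unset Printing Implicit Defensive.
Import Order.TTheory GRing.Theory Num.Theory.
Import numFieldNormedType.Exports.
Local Open Scope classical_set_scope.
Local Open Scope ring_scope.

(* R^n, rendered as the column vectors 'cV[R]_n, with the Borel sigma-algebra
   of its usual topology. *)
Definition borel_cV (R : realType) (n : nat) :=
  g_sigma_algebraType (@open 'cV[R]_n).

(* x^T A x *)
Definition quad_form (R : realType) (n : nat) (A : 'M[R]_n) (x : 'cV[R]_n) : R :=
  (x^T *m A *m x) 0 0.

Definition posdefmx (R : realType) (n : nat) (A : 'M[R]_n) : Prop :=
  A^T = A /\ forall x : 'cV[R]_n, x != 0 -> 0 < quad_form A x.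

Definition possemidefmx (R : realType) (n : nat) (A : 'M[R]_n) : Prop :=
  A^T = A /\ forall x : 'cV[R]_n, 0 <= quad_form A x.

Definition loewner_le (R : realType) (n : nat) (A B : 'M[R]_n) : Prop :=
  possemidefmx (B - A).

Definition ellipsoid (R : realType) (n : nat) (M : 'M[R]_n) : set 'cV[R]_n :=
  [set x | quad_form M x <= 1].

(* The set S / t is the image of S under scaling by t^-1. *)
Definition unimodal (R : realType) (n : nat) (alpha : R)
    (P : probability (borel_cV R n) R) : Prop :=
  forall S : set (borel_cV R n), measurable S ->
  forall s t : R, 0 < s -> s <= t ->
  ((s `^ alpha)%:E * P [set s^-1 *: (x : 'cV[R]_n) | x in S] <=
   (t `^ alpha)%:E * P [set t^-1 *: (x : 'cV[R]_n) | x in S])%E.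

(* Integrability is required explicitly wherever the moments are used, since
   [fine] sends infinite expectations to 0. *)
Definition has_moments (R : realType) (n : nat)
    (P : probability (borel_cV R n) R) : Prop :=
  (forall i : 'I_n,
     P.-integrable setT (fun x : 'cV[R]_n => (x i 0)%:E)) /\
  (forall i j : 'I_n,
     P.-integrable setT (fun x : 'cV[R]_n => (x i 0 * x j 0)%:E)).

Definition mean_vec (R : realType) (n : nat)
    (P : probability (borel_cV R n) R) : 'cV[R]_n :=
  \col_i fine 'E_P[fun x : 'cV[R]_n => x i 0].

(* E[(xi - m)(xi - m)^T] *)
Definition second_moment (R : realType) (n : nat)
    (P : probability (borel_cV R n) R) (m : 'cV[R]_n) : 'M[R]_n :=
  \matrix_(i, j) fine 'E_P[fun x : 'cV[R]_n => ((x - m) *m (x - m)^T) i j].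

Definition moment_ambiguity (R : realType) (n : nat) (mu0 : 'cV[R]_n)
    (S0 : 'M[R]_n) (gamma1 gamma2 : R) (Xi : set 'cV[R]_n) :
    set (probability (borel_cV R n) R) :=
  [set P : probability (borel_cV R n) R |
    [/\ P Xi = 1%E,
               has_moments P,
               quad_form (invmx S0) (mean_vec P - mu0) <= gamma1 &
               loewner_le (second_moment P mu0) (gamma2 *: S0)]].

Definition structured_ambiguity (R : realType) (n : nat) (alpha : R)
    (mu0 : 'cV[R]_n) (S0 : 'M[R]_n) (gamma1 gamma2 : R) (Xi : set 'cV[R]_n) :
    set (probability (borel_cV R n) R) :=
  moment_ambiguity mu0 S0 gamma1 gamma2 Xi `&`
  [set P : probability (borel_cV R n) R | unimodal alpha P].

Definition c_const (R : realType) (alpha : R) : R :=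
  (2 / (alpha + 2)) `^ (2 / alpha).

Definition S0_scaled (R : realType) (n : nat) (alpha : R) (S0 : 'M[R]_n) :
    'M[R]_n :=
  ((alpha + 2) / alpha) *: S0.

(* Main.v *)
Require Import Defs.
From mathcomp Require Import all_boot all_order all_algebra.
From mathcomp Require Import all_classical all_reals all_analysis.
From mathcomp Require Import measurable_realfun ring lra.
Import Order.TTheory GRing.Theory Num.Theory.
Import numFieldNormedType.Exports.
Local Open Scope classical_set_scope.
Local Open Scope ring_scope.
Set Implicit Arguments.
Unset Strict Implicit.

(** The theorem is a Gauss-type inequality for the one real random variable
    [X = quad_form M], the squared radius measured by [M].

    Write [b = alpha / 2], let [F] be the distribution function of [X], and let
    [p = F 1] be the mass of the ellipsoid.  Since [X] is homogeneous of degree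
    2, unimodality applied to the slabs [u < X <= v] compares the increments of
    [F] at different scales ([unimodal_cdf_increments]).  In the variable
    [w = u `^ b] this says that the chord slopes of [H w = F (w `^ b^-1)]
    decrease along geometric progressions, i.e. that [H] is concave; hence
    [H] lies below a line through [(1, p)] whose slope [s] satisfies
    [0 <= s <= p] ([scaled_tangent], up to a ratio [rho > 1] which can be taken
    arbitrarily close to 1).

    By the tail formula, [A] is at most ['E X] plus the integral of [F] over
    [[0, A]], and this integral is bounded by that of the line.  When
    [A `^ b >= 1 + b] the slope [s = p] is the worst case, which gives
      [A - p * A `^ (b + 1) / (b + 1) <= 'E X]
    ([expectation_ge_cdf1]).  Both branches of the bound come from this single
    inequality.  With [A = (c_const alpha)^-1], for which [A `^ b = 1 + b], it
    reads [A * (1 - p) <= 'E X] and gives the linear branch.  With [m] the upper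
    bound on ['E X] and [A = m * (b + 1) / b], it becomes [1 <= p * A `^ b],
    which is the other branch; this [A] is admissible exactly when
    [c_const alpha * m] is at least [alpha / (alpha + 2)].

    Finally ['E X] is the trace of [M] times the second moment matrix
    ([expectation_quad_form]).  That matrix is at most [gamma2 *: S0], and the
    trace of a product of two positive semidefinite matrices is nonnegative
    ([mxtrace_psd_ge0]), so that [m = gamma2 * \tr (M *m S0)] is such a
    bound. *)

(** * Quadratic forms and positive semidefinite matrices *)

Section psd.
Context {R : realType} {n : nat}.
Implicit Types (M N : 'M[R]_n) (x y v : 'cV[R]_n).

Lemma quad_formZ M (t : R) x : quad_form M (t *: x) = t ^+ 2 * quad_form M x.
Proof.
by rewrite /quad_form -scalemxAr [(t *: x)^T]linearZ /= -!scalemxAl !mxE mulrA.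
Qed.

Lemma quad_formE M x :
  quad_form M x = \sum_i \sum_j M i j * (x i 0 * x j 0).
Proof.
rewrite /quad_form -mulmxA !mxE; apply: eq_bigr => i _.
rewrite !mxE mulr_sumr; apply: eq_bigr => j _; ring.
Qed.

Lemma quad_form_delta M i : quad_form M (delta_mx i 0) = M i i.
Proof. by rewrite /quad_form trmx_delta -rowE -colE !mxE. Qed.

Lemma quad_formD N x (t : R) i : N^T = N ->
  quad_form N (x + t *: delta_mx i 0) =
  quad_form N x + 2 * t * (N *m x) i 0 + t ^+ 2 * N i i.
Proof.
move=> symN; rewrite -(quad_form_delta N i) -(quad_formZ N t) /quad_form.
rewrite [(x + _)^T]linearD /= !mulmxDl !mulmxDr.
have -> : x^T *m N *m (t *: delta_mx i 0) = (t *: (N *m x) i 0)%:M.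
  rewrite -scalemxAr -colE -[x^T *m N]trmxK trmx_mul trmxK symN -tr_row.
  by apply/matrixP => j k; rewrite !ord1 !mxE eqxx mulr1n.
have -> : (t *: delta_mx i 0)^T *m N *m x = (t *: (N *m x) i 0)%:M.
  rewrite [(t *: _)^T]linearZ /= trmx_delta -!scalemxAl -mulmxA -rowE.
  by apply/matrixP => j k; rewrite !ord1 !mxE eqxx mulr1n.
by rewrite !mxE eqxx mulr1n /GRing.scale /=; ring.
Qed.

Lemma psd_diag_ge0 N i : possemidefmx N -> 0 <= N i i.
Proof. by case=> _ /(_ (delta_mx i 0)); rewrite quad_form_delta. Qed.

(** When the diagonal vanishes, the form at [e_j + t e_i] is [2 * t * N i j],
    which can be nonnegative for both signs of [t] only if [N i j = 0]. *)
Lemma psd_diag0 N : possemidefmx N -> (forall i, N i i = 0) -> N = 0.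
Proof.
move=> [symN psdN] diag0; apply/matrixP => i j; rewrite mxE.
have q t : 0 <= 2 * t * N i j.
  have := psdN (delta_mx j 0 + t *: delta_mx i 0).
  by rewrite quad_formD// quad_form_delta !diag0 mulr0 addr0 add0r -colE mxE.
apply/le_anti/andP; split; last by have := q 1; rewrite mulr1 pmulr_rge0.
by have := q (-1); rewrite mulrN1 mulNr oppr_ge0 pmulr_rle0.
Qed.

(** The form of the Schur complement at [x] is the minimum over [t] of
    [quad_form N (x + t *: delta_mx i 0)]. *)
Lemma psd_schur N i : possemidefmx N -> N i i != 0 ->
  possemidefmx (N - (N i i)^-1 *: (col i N *m (col i N)^T)).
Proof.
move=> [symN psdN] Nii0; split.
  by rewrite linearB /= linearZ /= trmx_mul trmxK symN.
move=> x; pose w := (N *m x) i 0.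
have -> : quad_form (N - (N i i)^-1 *: (col i N *m (col i N)^T)) x =
          quad_form N (x + (- (w / N i i)) *: delta_mx i 0).
  rewrite quad_formD// -/w /quad_form mulmxBr mulmxBl -scalemxAr -scalemxAl.
  have rw : (col i N)^T *m x = w%:M.
    rewrite tr_col symN rowE -mulmxA -rowE.
    by apply/matrixP => j k; rewrite /w !ord1 !mxE eqxx mulr1n.
  have -> : x^T *m (col i N *m (col i N)^T) *m x = w%:M *m w%:M.
    rewrite mulmxA -mulmxA rw -[x^T *m _]trmxK trmx_mul trmxK rw.
    by rewrite tr_scalar_mx.
  rewrite -scalar_mxM !mxE eqxx mulr1n.
  by field.
exact: psdN.
Qed.

(** Passing repeatedly to Schur complements writes [N] as a nonnegative
    combination of matrices [v *m v^T], and [v *m v^T] contributes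
    [quad_form M v] to the trace.  The induction is on the number of nonzero
    diagonal entries, each step clearing at least one. *)
Lemma mxtrace_psd_ge0 M N :
  possemidefmx M -> possemidefmx N -> 0 <= \tr (M *m N).
Proof.
move=> psdM; have [k] := ubnP #|[set i | N i i != 0]%SET|.
elim: k N => // k IH N ltk psdN.
have [[i Nii]|diag0] := pselect (exists i, N i i != 0); last first.
  rewrite (psd_diag0 psdN) ?mulmx0 ?mxtrace0// => i; apply/eqP.
  by apply: contrapT => /negP Nii; apply: diag0; exists i.
have Nii0 : 0 < N i i by rewrite lt_neqAle eq_sym Nii psd_diag_ge0.
set v := col i N; set N' := N - (N i i)^-1 *: (v *m v^T).
have psdN' : possemidefmx N' by exact: psd_schur.
have -> : N = N' + (N i i)^-1 *: (v *m v^T) by rewrite subrK.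
rewrite mulmxDr mxtraceD -scalemxAr mxtraceZ addr_ge0//; last first.
  rewrite mulr_ge0 ?invr_ge0 ?(ltW Nii0)// mulmxA mxtrace_mulC mulmxA.
  by rewrite /mxtrace big_ord1; exact: psdM.2.
apply: (IH _ _ psdN'); rewrite ltnS in ltk; apply: leq_trans ltk.
apply: proper_card.
have NE j : N' j j = N j j - (N i i)^-1 * (N j i) ^+ 2.
  by rewrite !mxE big_ord1 !mxE expr2.
apply/properP; split; last first.
  exists i; rewrite !inE// NE negbK expr2 mulrA mulVf// mul1r subrr//.
apply/fintype.subsetP => j; rewrite !inE; apply: contraNN => /eqP Njj.
rewrite eq_le psd_diag_ge0// andbT NE Njj sub0r oppr_le0.
by rewrite mulr_ge0 ?invr_ge0 ?(ltW Nii0)// sqr_ge0.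
Qed.

End psd.

(** * Concavity from a scaling inequality *)

Section tangent.
Context {R : realType}.

Lemma exists_exprz_ge (rho w : R) : 1 < rho -> 0 < w ->
  exists z : int, w <= rho ^ z /\ rho ^ z <= rho * w.
Proof.
move=> rho1 w0; have rho0 : 0 < rho by lra.
have lrho : 0 < ln rho by rewrite ln_gt0.
have E z : rho ^ z = expR (z%:~R * ln rho).
  by rewrite -powR_intmul ?ltW// /powR gt_eqF.
exists (Num.ceil (ln w / ln rho)); rewrite E.
have -> : rho * w = expR (ln rho + ln w) by rewrite expRD !lnK.
rewrite -{1}(lnK w0) !ler_expR.
rewrite -ler_pdivrMr// ceil_ge; split=> //.
rewrite -ler_pdivlMr// mulrDl divff ?gt_eqF// addrC.
by have := ceilB1_lt (ln w / ln rho); lra.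
Qed.

Context (H : R -> R).
Context (Hge0 : forall w, 0 <= w -> 0 <= H w).
Context (Hnd : forall v w, 0 <= v -> v <= w -> H v <= H w).
Context (Hscale : forall t v w, 0 < t -> t <= 1 -> 0 <= v -> v <= w ->
  t * (H w - H v) <= H (t * w) - H (t * v)).

(** [Hscale] makes the slope of [H] on [[rho ^ k, rho ^ (k + 1)]] decrease in
    the integer [k], so on the grid [rho ^ k] the function [H] lies below the
    line through its points at 1 and [rho].  Monotonicity of [H] extends the
    bound to the points off the grid, at the price of the factor [rho]. *)
Lemma scaled_tangent (rho : R) : 1 < rho ->
  exists s, [/\ 0 <= s, s <= H 1 &
    forall w, 0 <= w -> H w <= H 1 + s * (rho * w - 1)].
Proof.
move=> rho1; have rho0 : 0 < rho by lra.
have rhoN0 : rho != 0 by rewrite gt_eqF.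
have drho : 0 < rho - 1 by lra.
(* The slope of the chord over [[1, rho]]. *)
pose s := (H rho - H 1) / (rho - 1).
have sE : H rho - H 1 = s * (rho - 1) by rewrite divfK ?gt_eqF.
have s0 : 0 <= s by rewrite divr_ge0 ?subr_ge0 ?Hnd// ltW.
have rX k : 0 < rho ^+ k by rewrite exprn_gt0.
have rX1 k : rho ^- k <= 1 by rewrite invf_le1// exprn_ege1// ltW.
have up k : H (rho ^+ k) <= H 1 + s * (rho ^+ k - 1).
  elim: k => [|k IH]; first by rewrite expr0 subrr mulr0 addr0.
  have := @Hscale (rho ^- k) (rho ^+ k) (rho ^+ k.+1).
  rewrite invr_gt0 rX rX1 ltW//= => /(_ isT isT isT).
  rewrite ler_eXn2l// leqnSn => /(_ isT).
  rewrite mulVf ?(gt_eqF (rX k))// exprSr mulKf ?gt_eqF// sE.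
  rewrite ler_pdivrMl//; lra.
have down k : H (rho ^- k) <= H 1 + s * (rho ^- k - 1).
  elim: k => [|k IH]; first by rewrite expr0 invr1 subrr mulr0 addr0.
  have := @Hscale (rho ^- k.+1) 1 rho.
  rewrite invr_gt0 rX rX1 ler01 (ltW rho1) => /(_ isT isT isT isT).
  rewrite sE mulr1.
  have -> : rho ^- k.+1 * rho = rho ^- k.
    by rewrite exprSr invfM -mulrA mulVf// mulr1.
  have -> : rho ^- k.+1 * (s * (rho - 1)) = s * (rho ^- k - rho ^- k.+1).
    by rewrite exprSr; field; rewrite rhoN0 gt_eqF.
  by move: IH; lra.
have grid z : H (rho ^ z) <= H 1 + s * (rho ^ z - 1).
  by case: z => k; [exact: up | exact: down].
(* The chord over [[0, 1]] is at least as steep as the one over [[1, rho]]. *)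
have H0s : H 0 + s <= H 1.
  have := @Hscale rho^-1 0 rho.
  rewrite invr_gt0 invf_le1// lexx rho0 (ltW rho1) (ltW rho0).
  move=> /(_ isT isT isT isT).
  rewrite mulr0 mulVf// ler_pdivrMl// => h.
  rewrite -(ler_pM2r drho) mulrDl -sE; lra.
exists s; split => //; first by have := Hge0 (lexx 0); lra.
move=> w; rewrite le_eqVlt => /predU1P[<-|w0].
  by rewrite mulr0; lra.
have [z [wz zw]] := exists_exprz_ge rho1 w0.
apply: le_trans (Hnd (ltW w0) wz) _; apply: le_trans (grid z) _.
by rewrite lerD2l ler_wpM2l// lerD2r.
Qed.

End tangent.

(** * The integral of a real power *)

Section pow.
Context {R : realType}.
Local Notation mu := (@lebesgue_measure R).

Lemma continuous_powR_pos (b u : R) : 0 < u ->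
  (fun x : R => x `^ b) @ u --> u `^ b.
Proof.
move=> u0; apply: (@differentiable_continuous _ _ _ u (fun x : R => x `^ b)).
apply/derivable1_diffP.
by apply: derivable_powR; rewrite in_itv/= u0.
Qed.

Lemma cvg_powR_right0 (b : R) : 0 < b ->
  (fun x : R => x `^ b) @ 0^'+ --> 0 `^ b.
Proof. by move=> b0; rewrite powR0 ?gt_eqF//; exact: powR_cvg0. Qed.

Lemma cvg_powR_left (b A : R) : 0 < A ->
  (fun x : R => x `^ b) @ A^'- --> A `^ b.
Proof. by move=> A0; exact/cvg_at_left_filter/continuous_powR_pos. Qed.

Lemma integral_powR (b A : R) : 0 < b -> 0 < A ->
  (\int[mu]_(u in `[0%R, A]) (u `^ b)%:E = (A `^ (b + 1) / (b + 1))%:E)%E.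
Proof.
move=> b0 A0; have b1 : 0 < b + 1 by lra.
rewrite (@continuous_FTC2 _ _ (fun u => (b + 1)^-1 * u `^ (b + 1)))//.
- by rewrite powR0 ?gt_eqF// mulr0 sube0 mulrC.
- apply/continuous_within_itvP => //; split.
  + by move=> u; rewrite in_itv/= => /andP[u0 _]; exact: continuous_powR_pos.
  + exact: cvg_powR_right0.
  + exact: cvg_powR_left.
- split.
  + move=> u; rewrite in_itv/= => /andP[u0 _].
    by apply: derivableM => //; apply: derivable_powR; rewrite in_itv/= u0.
  + by apply: cvgMl_tmp; exact: cvg_powR_right0.
  + by apply: cvgMl_tmp; exact: cvg_powR_left.
- move=> u; rewrite in_itv/= => /andP[u0 _].
  rewrite derive1E deriveM//; last first.
    by apply: derivable_powR; rewrite in_itv/= u0.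
  have := @is_derive1_powR R (b + 1) u u0.
  case=> _ ->; rewrite derive_cst scaler0 addr0 /GRing.scale /= addrK.
  by rewrite mulrA mulVf ?gt_eqF// mul1r.
Qed.

End pow.

(** * A lower bound on the expectation *)

(** The distribution function of a nonnegative quadratic form of an
    [alpha]-unimodal vector has this property with [b = alpha / 2].  For a
    nondecreasing [F] it amounts to concavity in the variable [u `^ b]. *)
Definition unimodal_increments (R : realType) (b : R) (F : R -> R) :=
  forall t u v, 0 < t -> t <= 1 -> 0 <= u -> u <= v ->
    t `^ b * (F v - F u) <= F (t * v) - F (t * u).

Section tail.
Context d (T : measurableType d) (R : realType) (P : probability T R).
Context (X : {RV P >-> R}) (b : R).
Local Notation mu := (@lebesgue_measure R).
Local Notation F u := (fine (cdf X u)).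
Context (b0 : 0 < b) (X0 : forall x, 0 <= X x).
Context (Fincr : unimodal_increments b (fun u => F u)).

Lemma cdf_fineK (u : R) : (F u)%:E = cdf X u.
Proof. by rewrite fineK// fin_num_measure. Qed.

Lemma fine_cdf_ge0 (u : R) : 0 <= F u.
Proof. by rewrite fine_ge0. Qed.

Lemma fine_cdf_nd (u v : R) : u <= v -> F u <= F v.
Proof. by move=> uv; rewrite -lee_fin !cdf_fineK; exact: cdf_nondecreasing. Qed.

Lemma cdf_tangent (rho : R) : 1 < rho ->
  exists s, [/\ 0 <= s, s <= F 1 &
    forall u, 0 <= u -> F u <= F 1 + s * (rho * u `^ b - 1)].
Proof.
move=> rho1; have bN0 : b != 0 by rewrite gt_eqF.
pose H w := F (w `^ b^-1).
have bV0 : 0 <= b^-1 by rewrite invr_ge0 ltW.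
have [|||s [s0 sp sH]] := @scaled_tangent R H _ _ _ rho rho1.
- by move=> w _; exact: fine_cdf_ge0.
- move=> v w v0 vw; apply: fine_cdf_nd.
  by rewrite ge0_ler_powR// nnegrE (le_trans v0).
- move=> t v w t0 t1 v0 vw; rewrite /H !powRM ?(ltW t0) ?(le_trans v0 vw)//.
  have {1}-> : t = (t `^ b^-1) `^ b by rewrite -powRrM mulVf// powRr1// ltW.
  apply: Fincr; rewrite ?powR_gt0 ?powR_ge0//.
    have E1 : 1 `^ b^-1 = 1 :> R by rewrite powR1.
    by rewrite -[leRHS]E1 ge0_ler_powR// nnegrE// ltW.
  by rewrite ge0_ler_powR// nnegrE (le_trans v0).
exists s; rewrite /H powR1 in sp sH; split=> // u u0.
have := sH (u `^ b); rewrite powR_ge0 -powRrM divff// powRr1//; exact.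
Qed.

Lemma integral_cdf_le (A p s rho : R) :
  0 < A -> 0 <= rho -> 0 <= s -> s <= p ->
  (forall u, 0 <= u -> F u <= p + s * (rho * u `^ b - 1)) ->
  (\int[mu]_(u in `[0%R, A]) cdf X u <=
   ((p - s) * A + s * rho * (A `^ (b + 1) / (b + 1)))%:E)%E.
Proof.
move=> A0 rho0 s0 sp Fle.
have mpow : measurable_fun `[0%R, A] (fun u : R => u `^ b).
  by apply: measurable_funTS; exact: measurable_powR.
have -> : ((p - s) * A + s * rho * (A `^ (b + 1) / (b + 1)))%:E =
    (\int[mu]_(u in `[0%R, A]) ((p - s)%:E + (s * rho)%:E * (u `^ b)%:E))%E.
  rewrite ge0_integralD//=; first last.
  - apply: measurable_funeM; exact/measurable_EFinP.
  - by move=> u _; rewrite mule_ge0// lee_fin ?powR_ge0// mulr_ge0.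
  - by move=> u _; rewrite lee_fin subr_ge0.
  rewrite integral_cst//= lebesgue_measure_itv/= lte_fin A0 sube0.
  rewrite ge0_integralZl//=; first last.
  - by rewrite lee_fin mulr_ge0.
  - by move=> u _; rewrite lee_fin powR_ge0.
  - exact/measurable_EFinP.
  by rewrite integral_powR// EFinD !EFinM.
apply: ge0_le_integral => //=.
- apply: measurable_funTS; exact: cdf_measurable.
- apply: emeasurable_funD => //.
  by apply: measurable_funeM; exact/measurable_EFinP.
- move=> u; rewrite in_itv/= => /andP[u0 _].
  rewrite -cdf_fineK -EFinM -EFinD lee_fin; apply: le_trans (Fle _ u0) _; lra.
Qed.

(** Since [ccdf X + cdf X = 1], the tail formula, cut off at [A], gives this. *)
Lemma le_expectation_integral_cdf (A : R) : 0 < A ->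
  (A%:E <= 'E_P[X] + \int[mu]_(u in `[0%R, A]) cdf X u)%E.
Proof.
move=> A0; rewrite ge0_expectation_ccdf//.
have -> : A%:E = (\int[mu]_(u in `[0%R, A]) (ccdf X u + cdf X u))%E.
  under eq_integral do rewrite ccdf_cdf_1.
  by rewrite integral_cst//= lebesgue_measure_itv/= lte_fin A0 sube0 mul1e.
rewrite ge0_integralD//=; last 2 first.
- by apply: measurable_funTS; exact: ccdf_measurable.
- by apply: measurable_funTS; exact: cdf_measurable.
rewrite leeD2r//; apply: ge0_subset_integral => //=.
- by apply: measurable_funTS; exact: ccdf_measurable.
- by move=> u; rewrite /= !in_itv/= => /andP[-> _].
Qed.

(** [integral_cdf_le] bounds the integral of the distribution function by
    [p * A + s * (rho * c - A)], with [p] its value at 1 and [c] as in the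
    proof.  As [A `^ b >= 1 + b] means [c >= A], this increases with [s], so
    [s] may be replaced by [p]; then [rho] tends to 1. *)
Lemma expectation_ge_cdf1 (A m : R) : 0 < A -> 1 + b <= A `^ b ->
  ('E_P[X] <= m%:E)%E ->
  A - F 1 * (A `^ (b + 1) / (b + 1)) <= m.
Proof.
move=> A0 Ab Em; have b1 : 0 < b + 1 by rewrite addr_gt0.
set c := A `^ (b + 1) / (b + 1).
have cA : A <= c.
  rewrite /c ler_pdivlMr// powRD; last by rewrite (gt_eqF A0) implybT.
  by rewrite powRr1 ?(ltW A0)// mulrC ler_pM2r//; lra.
rewrite lerBlDr.
have key rho : 1 < rho -> A <= m + rho * (F 1 * c).
  move=> rho1; have [s [s0 sp sF]] := cdf_tangent rho1.
  have rho0 : 0 <= rho by lra.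
  have := le_expectation_integral_cdf A0.
  move=> /le_trans/(_ (leeD Em (integral_cdf_le A0 rho0 s0 sp sF))).
  rewrite -EFinD lee_fin -/c => h.
  suff : (F 1 - s) * A <= (F 1 - s) * (rho * c) by move: h; lra.
  rewrite ler_wpM2l ?subr_ge0// (le_trans cA)// ler_peMl//; last exact: ltW.
  by rewrite (le_trans _ cA)// ltW.
have Fc0 : 0 <= F 1 * c.
  by rewrite mulr_ge0 ?fine_cdf_ge0// (le_trans _ cA)// ltW.
apply/ler_addgt0Pr => e e0.
have d0 : 0 < F 1 * c + 1 by lra.
have e'0 : 0 < e / (F 1 * c + 1) by rewrite divr_gt0.
apply: le_trans (key (1 + e / (F 1 * c + 1)) _) _; first lra.
rewrite mulrDl mul1r addrA lerD2l mulrAC ler_pdivrMr// ler_pM2l//; lra.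
Qed.

End tail.

(** * Gauss inequalities for the tail *)

Section gauss.
Context d (T : measurableType d) (R : realType) (P : probability T R).
Context (X : {RV P >-> R}) (b m : R).
Local Notation F u := (fine (cdf X u)).
Context (b0 : 0 < b) (X0 : forall x, 0 <= X x).
Context (Fincr : unimodal_increments b (fun u => F u)).
Context (Xm : ('E_P[X] <= m%:E)%E).

Lemma gauss_tail_linear (A : R) : 0 < A -> A `^ b = 1 + b -> A * (1 - F 1) <= m.
Proof.
move=> A0 Ab; have b1 : b + 1 != 0 by rewrite gt_eqF// addr_gt0.
have := expectation_ge_cdf1 b0 X0 Fincr A0 _ Xm.
rewrite powRD ?(gt_eqF A0) ?implybT// Ab powRr1 ?(ltW A0)// lexx => /(_ isT).
by rewrite [1 + b]addrC mulrAC divff// mul1r mulrBr mulr1 mulrC.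
Qed.

(** This value of [A] makes [A - m] equal to [A / (b + 1)], after which the
    inequality of [expectation_ge_cdf1] simplifies to [1 <= F 1 * A `^ b]. *)
Lemma gauss_tail_power : let A := m * (b + 1) / b in
  0 < A -> 1 + b <= A `^ b -> 1 - F 1 <= 1 - 1 / A `^ b.
Proof.
move=> A A0 Ab; have b1 : 0 < b + 1 by rewrite addr_gt0.
have Ab0 : 0 < A `^ b by rewrite powR_gt0.
have := expectation_ge_cdf1 b0 X0 Fincr A0 Ab Xm.
have -> : m = A - A / (b + 1) by rewrite /A; field; rewrite !gt_eqF.
rewrite powRD ?(gt_eqF A0) ?implybT// powRr1 ?(ltW A0)//.
rewrite lerD2l lerN2 mulrA mulrA ler_pM2r ?invr_gt0// ler_pMl// => h.
by rewrite lerD2l lerN2 ler_pdivrMr.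
Qed.

End gauss.

(** * Moments of the quadratic form *)

Section quad.
Context (R : realType) (n : nat) (P : probability (borel_cV R n) R).
Context (M : 'M[R]_n).

Lemma measurable_quad_form : has_moments P ->
  measurable_fun setT (quad_form M : borel_cV R n -> R).
Proof.
move=> [_ int2].
have -> : (quad_form M : borel_cV R n -> R) =
    fun x : 'cV[R]_n => \sum_i \sum_j M i j * (x i 0 * x j 0).
  by apply/funext => x; exact: quad_formE.
apply: measurable_sum => i; apply: measurable_sum => j.
apply: measurable_funM => //.
by have /measurable_int/measurable_EFinP := int2 i j.
Qed.

Lemma expectation_quad_form : has_moments P ->
  ('E_P[quad_form M] = (\tr (M *m second_moment P 0))%:E)%E.
Proof.
move=> [_ int2].
have int2Z i j : P.-integrable setT
    (fun x : 'cV[R]_n => (M i j * (x i 0 * x j 0))%:E).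
  under eq_fun do rewrite EFinM.
  exact: integrableZl.
have SE i j : (second_moment P 0 j i)%:E =
    (\int[P]_x ((x : 'cV[R]_n) i 0 * (x : 'cV[R]_n) j 0)%:E)%E.
  rewrite mxE unlock -[RHS]fineK; last exact: integrable_fin_num.
  congr (fine _)%:E; apply: eq_integral => x _.
  by rewrite subr0 !mxE big_ord1 !mxE mulrC.
rewrite unlock.
transitivity (\int[P]_x (\sum_i \sum_j
    (M i j * ((x : 'cV[R]_n) i 0 * (x : 'cV[R]_n) j 0))%:E))%E.
  apply: eq_integral => x _; rewrite quad_formE -sumEFin.
  by apply: eq_bigr => i _; rewrite sumEFin.
rewrite integral_sum//; last by move=> i; apply: integrable_sum => // j.
rewrite /mxtrace -sumEFin; apply: eq_bigr => i _.
rewrite integral_sum// mxE -sumEFin; apply: eq_bigr => j _.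
rewrite EFinM SE; under eq_integral do rewrite EFinM.
by rewrite integralZl.
Qed.

End quad.

Lemma mxtrace_second_moment_le (R : realType) (n : nat) (M S : 'M[R]_n)
    (P : probability (borel_cV R n) R) :
  possemidefmx M -> loewner_le (second_moment P 0) S ->
  \tr (M *m second_moment P 0) <= \tr (M *m S).
Proof.
by move=> psdM psdS; rewrite -subr_ge0 -raddfB -mulmxBr mxtrace_psd_ge0.
Qed.

(** * Unimodality in terms of the quadratic form *)

Section unimodal.
Context (R : realType) (n : nat) (alpha : R) (P : probability (borel_cV R n) R).
Context (M : 'M[R]_n) (X : {RV P >-> R}).
Context (XE : X = quad_form M :> ('cV[R]_n -> R)) (uniP : unimodal alpha P).
Local Notation F u := (fine (cdf X u)).

Lemma probability_slab (t a b : R) : 0 < t -> a <= b ->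
  P [set t^-1 *: (x : 'cV[R]_n) | x in X @^-1` `]a, b]] =
  (F (t ^- 2 * b) - F (t ^- 2 * a))%:E.
Proof.
move=> t0 ab; have tV0 : 0 < t ^- 2 by rewrite invr_gt0 exprn_gt0.
have -> : [set t^-1 *: (x : 'cV[R]_n) | x in X @^-1` `]a, b]] =
          X @^-1` `]-oo, t ^- 2 * b] `\` X @^-1` `]-oo, t ^- 2 * a].
  rewrite XE; apply/seteqP; split => [_ [x /= + <-]|x /=].
    rewrite !in_itv/= quad_formZ exprVn => /andP[ax xb].
    by split; [rewrite ler_pM2l | apply/negP; rewrite -ltNge ltr_pM2l].
  rewrite !in_itv/= => -[xb /negP]; rewrite -ltNge => ax.
  exists (t *: x); last by rewrite scalerA mulVf ?scale1r// gt_eqF.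
  rewrite /= in_itv/= quad_formZ.
  by rewrite -ltr_pdivrMl ?ax ?exprn_gt0//= -ler_pdivlMl ?exprn_gt0.
rewrite measureD//=; [|exact: measurable_funPTI..|]; last first.
  by rewrite -ge0_fin_numE// fin_num_measure//; exact: measurable_funPTI.
rewrite setIidr; last first.
  by move=> x /=; rewrite !in_itv/= => /le_trans; apply; rewrite ler_pM2l.
by rewrite EFinB !fineK// fin_num_measure.
Qed.

(** Unimodality for the slab [u < X <= v], compared at the scales 1 and
    [r = t `^ (- 2^-1)], for which [r ^- 2 = t]. *)
Lemma unimodal_cdf_increments : unimodal_increments (alpha / 2) (fun u => F u).
Proof.
move=> t u v t0 t1 u0 uv; pose r := t `^ (- 2^-1).
have r0 : 0 < r by rewrite powR_gt0.
have r2 : r ^- 2 = t.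
  rewrite -powR_mulrn ?powR_ge0// -powRrM mulNr mulVf// powRN.
  by rewrite powRr1 ?invrK// ltW.
have ralpha : r `^ alpha = (t `^ (alpha / 2))^-1.
  by rewrite -powRrM mulNr powRN mulrC.
have r1 : 1 <= r.
  by rewrite /r powRN invf_ge1 ?powR_gt0// -[leRHS](powRr0 t) ger_powR ?t0 ?t1.
have mS : measurable (X @^-1` `]u, v] : set (borel_cV R n)).
  exact: measurable_funPTI.
have := uniP mS ltr01 r1; rewrite !probability_slab// r2 powR1.
rewrite expr1n invr1 !mul1r mul1e -EFinM lee_fin ralpha.
by rewrite ler_pdivlMl// powR_gt0.
Qed.

End unimodal.

(** * The constant and the final bound *)

Lemma c_const_gt0 (R : realType) (alpha : R) : 0 < alpha -> 0 < c_const alpha.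
Proof. by move=> a0; rewrite powR_gt0// divr_gt0//; lra. Qed.

(** [(c_const alpha)^-1] is the smallest [A] admissible in
    [expectation_ge_cdf1]. *)
Lemma c_constK (R : realType) (alpha : R) : 0 < alpha ->
  (c_const alpha)^-1 `^ (alpha / 2) = 1 + alpha / 2.
Proof.
move=> a0; have a2 : 0 < alpha + 2 by lra.
rewrite -powRN /c_const -powRrM.
have -> : - (2 / alpha) * (alpha / 2) = -1 by field; rewrite gt_eqF.
rewrite powR_inv1 ?divr_ge0 ?(ltW a2)// invf_div.
by field.
Qed.

Unset Implicit Arguments.
Set Strict Implicit.

Theorem theorem2 (R : realType) (n : nat) (alpha gamma1 gamma2 : R)
    (S0 M : 'M[R]_n)
    (halpha : 0 < alpha)
    (hS0 : posdefmx S0)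
    (hgamma1 : 0 <= gamma1)
    (hgamma2 : Num.max gamma1 1 <= gamma2)
    (hM : possemidefmx M) :
  (ereal_sup [set P (~` ellipsoid M) |
              P in structured_ambiguity alpha 0 S0 gamma1 gamma2 setT]
   <= (if c_const alpha * gamma2 * \tr (M *m S0) <= alpha / (alpha + 2)
       then c_const alpha * gamma2 * \tr (M *m S0)
       else 1 - 1 / (gamma2 * \tr (M *m S0_scaled alpha S0)) `^ (alpha / 2))%:E)%E.
Proof.
apply: ge_ereal_sup => _ [P [[_ momP _ covP] uniP] <-].
have a2 : 0 < alpha + 2 by rewrite addr_gt0.
pose b := alpha / 2; have b0 : 0 < b by rewrite divr_gt0.
pose m := gamma2 * \tr (M *m S0).
pose X : {RV P >-> R} := mfun_Sub (mem_set (measurable_quad_form M momP)).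
have XE : X = quad_form M :> ('cV[R]_n -> R) by [].
have X0 x : 0 <= X x by rewrite XE; exact: hM.2.
have Xm : ('E_P[X] <= m%:E)%E.
  have -> : ('E_P[X] = 'E_P[quad_form M])%E by [].
  rewrite expectation_quad_form// lee_fin /m -mxtraceZ scalemxAr.
  exact: mxtrace_second_moment_le.
have Fincr := unimodal_cdf_increments XE uniP.
have -> : P (~` ellipsoid M) = (1 - fine (cdf X 1))%:E.
  rewrite EFinB fineK ?fin_num_measure// -ccdf_1_cdf; congr (P _).
  apply/seteqP; split=> x; rewrite /ellipsoid /= in_itv/= andbT.
    by move/negP; rewrite -ltNge.
  by rewrite ltNge => /negP.
have c0 := c_const_gt0 halpha.
rewrite -mulrA -/m lee_fin; case: ifPn => [_|].
  rewrite -ler_pdivrMl//.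
  apply: (gauss_tail_linear b0 X0 Fincr Xm); first by rewrite invr_gt0.
  exact: c_constK.
rewrite -ltNge => cm.
have -> : gamma2 * \tr (M *m S0_scaled alpha S0) = m * (b + 1) / b.
  rewrite /S0_scaled -scalemxAr mxtraceZ /m /b; field.
  by rewrite !gt_eqF.
have cA : (c_const alpha)^-1 < m * (b + 1) / b.
  have b1 : 0 < b + 1 by rewrite addr_gt0.
  have bE : alpha / (alpha + 2) = b / (b + 1).
    by rewrite /b; field; rewrite !gt_eqF// /b in b1 *.
  rewrite -[ltLHS]mulr1 ltr_pdivrMl// !mulrA ltr_pdivlMr// mul1r.
  by rewrite -ltr_pdivrMr// -bE -mulrA.
have A0 : 0 < m * (b + 1) / b by rewrite (lt_trans _ cA)// invr_gt0.
apply: (gauss_tail_power b0 X0 Fincr Xm) => //.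
rewrite -c_constK// ge0_ler_powR ?nnegrE ?invr_ge0 //; exact: ltW.
Qed.
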